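(* Let $n$ be a positive integer with $n\equiv\pm3\pmod 8$, and let $f\in\mathbb{F}_2[x]$ be an irreducible polynomial of degree $n$ with a root $\alpha\in\mathbb{F}_{2^n}$ such that $\mathrm{Tr}(\alpha^i)=0$ for each $1\le i<n$. Then $f(x)$ contains a term $x^k$ (that is, the coefficient of $x^k$ in $f$ is nonzero) for some integer $k$ with $n>k\ge n/3$.
   Context: $\mathbb{F}_{2^n}$ is the field with $2^n$ elements and $\mathrm{Tr}:\mathbb{F}_{2^n}\to\mathbb{F}_2$ is the trace map of the extension $\mathbb{F}_{2^n}/\mathbb{F}_2$, $\mathrm{Tr}(y)=\sum_{j=0}^{n-1}y^{2^j}$. *)

(* Defs.v *)
From HB Require Import structures.
From mathcomp Require Import all_boot all_order all_algebra all_field.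

Set Implicit Arguments.
Unset Strict Implicit.
Unset Printing Implicit Defensive.

Import GRing.Theory.
Local Open Scope ring_scope.

(* For #|F| = 2 ^ n this is the trace of F over 'F_2, with its value regarded
   as an element of F: by [abs_trace_prime] it lies in the prime subfield. *)
Definition abs_trace (F : finFieldType) (n : nat) (y : F) : F :=
  \sum_(j < n) y ^+ (2 ^ j).

Lemma abs_trace_prime (F : finFieldType) (n : nat) (y : F) :
  #|F| = (2 ^ n)%N -> abs_trace n y = 0 \/ abs_trace n y = 1.
Proof.
move=> cF.
have n_gt0 : (0 < n)%N.
  by case: n cF => // cF; have := finNzRing_gt1 F; rewrite cF.
have ch2 : 2 \in [pchar F] by exact: card_finPcharP cF _.
have frobE : abs_trace n y ^+ 2 = abs_trace n y.
  rewrite -[_ ^+ 2](pFrobenius_autE ch2) /abs_trace rmorph_sum /=.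
  case: n cF n_gt0 => // m cF _.
  rewrite big_ord_recr big_ord_recl /= addrC expn0 expr1; congr (_ + _).
    by rewrite pFrobenius_autE -exprM -expnSr -cF expf_card.
  by apply: eq_bigr => i _; rewrite pFrobenius_autE -exprM -expnSr.
have /eqP : abs_trace n y * (abs_trace n y - 1) = 0.
  by rewrite mulrBr mulr1 -expr2 frobE subrr.
rewrite mulf_eq0 subr_eq0 => /orP[] /eqP; by [left | right].
Qed.

(* Main.v *)
Require Import Defs.
From HB Require Import structures.
From mathcomp Require Import all_boot all_order all_fingroup all_algebra all_field.
From mathcomp Require Import mpoly ring zify.

Set Implicit Arguments.
Unset Strict Implicit.
Unset Printing Implicit Defensive.

Import GRing.Theory Num.Theory.
Local Open Scope ring_scope.

(** Suppose [f] has no term [x^k] with [n > k >= n/3]. Newton's identities and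
    the vanishing traces show that the only even exponent in [f] is [0]. Let [G]
    be the lift of [f] to [int] with coefficients [0] and [1]; then
    [X G' = n G - n + 2 h] with [h] of degree below [n/3], and the power sums
    [p_k] of the roots of [G] vanish for [0 < k < 2n/3], so the discriminant of
    [G], which is up to sign the product of the values of [X G'] at the roots,
    is [+- n = +-3] modulo [8].

    On the other hand it is [1] modulo [8] (Stickelberger): the Vandermonde
    determinant is [A - B] with [A] and [B] the sums over even and odd
    permutations, and the discriminant is [S^2 - 4 P] where [S = A + B] and
    [P = A B] are integer polynomials in the coefficients of [G]. Modulo [2] the
    Frobenius permutes the roots of [f] by an [n]-cycle, which is even, so [A]
    and [B] lie in ['F_2]; hence [S] and [P] are not both odd. *)

(** * Symmetric integer polynomials evaluated at roots *)

Lemma mmap_comp_mpoly (n m : nat) (R : comNzRingType) (S : comNzRingType)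
    (f : {rmorphism R -> S}) (x : 'I_m -> S) (lq : n.-tuple {mpoly R[m]})
    (p : {mpoly R[n]}) :
  mmap f x (p \mPo lq) = mmap f (fun i => mmap f x (tnth lq i)) p.
Proof.
rewrite /comp_mpoly [mmap _ (tnth lq) p]/mmap raddf_sum /=; apply: eq_bigr => k _.
rewrite rmorphM /= mmapC /mmap1 rmorph_prod /=; congr (_ * _).
by apply: eq_bigr => i _; rewrite rmorphXn.
Qed.

Lemma mmap_mesym (R : idomainType) (n k : nat) (x : 'I_n -> R) : (k <= n)%N ->
  mmap intr x (mesym n int k)
    = (-1) ^+ k * (\prod_(i < n) ('X - (x i)%:P))`_(n - k).
Proof.
move=> le_kn; pose cs := [tuple x i | i < n].
have -> : \prod_(i < n) ('X - (x i)%:P) = \prod_(c <- cs) ('X - c%:P).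
  by rewrite big_tuple; apply: eq_bigr => i _; rewrite tnth_mktuple.
have /= -> := mroots_coeff cs (Ordinal (le_kn : (k < n.+1)%N)).
rewrite mulrA -exprMn mulrNN mulr1 expr1n mul1r /mesym !raddf_sum /=.
apply: eq_bigr => h _; rewrite !rmorph_prod /=; apply: eq_bigr => j _.
by rewrite mmapX mmap1U mevalXU tnth_mktuple.
Qed.

(** The same [z] serves every [R]: this links the roots in [algC] of an integer
    polynomial to the roots of its reduction modulo [2]. *)
Lemma sym_mmap_int (n : nat) (p : {mpoly int[n]}) (G : {poly int}) :
  p \is symmetric -> exists z : int, forall (R : idomainType) (x : 'I_n -> R),
    map_poly intr G = \prod_(i < n) ('X - (x i)%:P) -> mmap intr x p = z%:~R.
Proof.
move=> /sym_fundamental[t [<- _]].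
(* By Vieta, the arguments given to [t] are the elementary symmetric functions of the roots;
   variable [i] stands for the one of degree [i.+1]. *)
exists (t.@[fun i => (-1) ^+ i.+1 * G`_(n - i.+1)]) => R x GE.
rewrite mmap_comp_mpoly /meval [mmap idfun _ t]/mmap rmorph_sum; apply: eq_bigr => m _.
rewrite rmorphM /=; congr (_ * _); rewrite /mmap1 rmorph_prod /=.
apply: eq_bigr => i _; rewrite rmorphXn /=; congr (_ ^+ _).
rewrite tnth_mktuple mmap_mesym // -GE coef_map rmorphM rmorphXn /=.
by rewrite rmorphN1.
Qed.

(** * Newton's identities *)

(** Synthetic division: each coefficient of [q] is the next one of the product plus [x] times the
    next one of [q]; the recursion ends at the size bound. *)
Lemma coef_linear_cofactor (R : comNzRingType) (q : {poly R}) (x : R) m a :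
  (size q <= a + m)%N ->
  q`_a = \sum_(k < m) (q * ('X - x%:P))`_(a.+1 + k) * x ^+ k.
Proof.
elim: m a => [|m IHm] a size_q.
  by rewrite big_ord0 nth_default // -[a]addn0.
have qE b : (q * ('X - x%:P))`_b.+1 = q`_b - q`_b.+1 * x.
  by rewrite mulrBr coefB coefMX coefMC.
rewrite big_ord_recl /= addn0 mulr1 qE.
rewrite (IHm a.+1) ?addSnnS // mulr_suml -addrA -[LHS]addr0; congr (_ + _).
apply/esym/eqP; rewrite addrC subr_eq0; apply/eqP/eq_bigr => k _.
by rewrite /bump /= add1n exprSr mulrA !addSnnS.
Qed.

Lemma deriv_prod_XsubC (R : comNzRingType) n (x : 'I_n -> R) :
  (\prod_(i < n) ('X - (x i)%:P))^`()
    = \sum_(i < n) \prod_(j < n | j != i) ('X - (x j)%:P).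
Proof.
elim: n x => [|n IHn] x; first by rewrite !big_ord0 derivC.
rewrite big_ord_recl derivM derivXsubC mul1r IHn big_ord_recl; congr (_ + _).
  by rewrite [RHS]big_mkcond big_ord_recl eqxx /= mul1r; apply: eq_bigr.
rewrite mulr_sumr; apply: eq_bigr => i _.
rewrite [RHS]big_mkcond big_ord_recl /=; congr (_ * _).
rewrite big_mkcond; apply: eq_bigr => j _.
by rewrite (inj_eq lift_inj).
Qed.

Lemma horner_deriv_prod_XsubC (R : comNzRingType) n (x : 'I_n -> R) i :
  (\prod_(j < n) ('X - (x j)%:P))^`().[x i] = \prod_(j < n | j != i) (x i - x j).
Proof.
rewrite deriv_prod_XsubC horner_sum (bigD1 i) //= [X in _ + X]big1 => [|k ne_ki].
  by rewrite addr0 horner_prod; apply: eq_bigr => j _; rewrite hornerXsubC.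
rewrite (bigD1 i) 1?eq_sym //= hornerM hornerXsubC subrr mul0r //.
Qed.

(** The derivative is the sum of the cofactors of the linear factors, and synthetic division gives
    their coefficients. Being division-free, this form serves [algC] and characteristic 2 alike. The
    term [k = 0] carries the factor [n]. *)
Lemma newton_prod_XsubC (R : idomainType) n (x : 'I_n -> R) a :
  let Q := \prod_(i < n) ('X - (x i)%:P) in
  Q`_a.+1 *+ a.+1 = \sum_(k < n - a) Q`_(a.+1 + k) * \sum_(i < n) x i ^+ k.
Proof.
move=> Q; rewrite -coef_deriv deriv_prod_XsubC coef_sum.
under [RHS]eq_bigr => k _ do rewrite mulr_sumr.
rewrite exchange_big; apply: eq_bigr => i _ /=.
have QE : Q = \prod_(j < n | j != i) ('X - (x j)%:P) * ('X - (x i)%:P).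
  by rewrite /Q (bigD1 i) //= mulrC.
rewrite QE -coef_linear_cofactor // -big_filter size_prod_XsubC size_filter.
suff -> : (count (fun j => j != i) (index_enum 'I_n)).+1 = n by lia.
rewrite -sum1_count (sum1_card (predC1 i)) cardC1 card_ord.
by case: n i {x Q QE} => [[]|].
Qed.

(** * The two halves of the Vandermonde determinant *)

(** [b = false] gives [A] and [b = true] gives [B]. The ring is arbitrary so that [x] can be
    indeterminates, roots in [algC] or roots in a finite field. *)
Definition vdm_half (R : comNzRingType) n (b : bool) (x : 'I_n -> R) : R :=
  \sum_(s : 'S_n | odd_perm s == b) \prod_(i < n) x (s i) ^+ i.

Lemma eq_vdm_half (R : comNzRingType) n b (x y : 'I_n -> R) :
  x =1 y -> vdm_half b x = vdm_half b y.
Proof.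
by move=> eq_xy; apply: eq_bigr => s _; apply: eq_bigr => i _; rewrite eq_xy.
Qed.

Lemma rmorph_vdm_half (R S : comNzRingType) (f : {rmorphism R -> S}) n b
    (x : 'I_n -> R) :
  f (vdm_half b x) = vdm_half b (f \o x).
Proof.
rewrite rmorph_sum; apply: eq_bigr => s _; rewrite rmorph_prod.
by apply: eq_bigr => i _; rewrite rmorphXn.
Qed.

(** An odd renaming of the variables exchanges the halves, which makes their sum and product
    symmetric. *)
Lemma vdm_half_perm (R : comNzRingType) n b (x : 'I_n -> R) (t : 'S_n) :
  vdm_half b (x \o t) = vdm_half (b (+) odd_perm t) x.
Proof.
rewrite [RHS](reindex_inj (mulIg t)) /=; apply: eq_big => [s | s _].
  by rewrite odd_permM; case: (odd_perm s); case: (odd_perm t); case: b.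
by apply: eq_bigr => i _; rewrite permM.
Qed.

Lemma vdm_halfB (R : comNzRingType) n (x : 'I_n -> R) :
  vdm_half false x - vdm_half true x
    = \prod_(i < n) \prod_(j < n | (i < j)%N) (x j - x i).
Proof.
transitivity (\det (Vandermonde n (\row_i x i))).
  rewrite /determinant (bigID (fun s : 'S_n => odd_perm s == false)) /=.
  rewrite -sumrN; congr (_ + _).
    apply: eq_bigr => s /eqP->; rewrite mul1r.
    by apply: eq_bigr => i _; rewrite !mxE.
  apply: eq_big => [s | s]; first by case: odd_perm.
  case: odd_perm => // _; rewrite expr1 mulN1r; congr (- _).
  by apply: eq_bigr => i _; rewrite !mxE.
rewrite det_Vandermonde; apply: eq_bigr => i _; apply: eq_bigr => j _.
by rewrite !mxE.
Qed.

Lemma msym_vdm_half n b (s : 'S_n) :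
  msym s (vdm_half b (fun i : 'I_n => 'X_i : {mpoly int[n]}))
    = vdm_half (b (+) odd_perm s) (fun i : 'I_n => 'X_i : {mpoly int[n]}).
Proof.
rewrite -vdm_half_perm rmorph_vdm_half; apply: eq_vdm_half => i /=.
by rewrite /msym mmapX mmap1U.
Qed.

Lemma sym_vdm_halfD n :
  vdm_half false (fun i : 'I_n => 'X_i : {mpoly int[n]})
    + vdm_half true (fun i : 'I_n => 'X_i) \is symmetric.
Proof.
apply/issymP => s; rewrite msymD !msym_vdm_half.
by case: odd_perm; rewrite //= addrC.
Qed.

Lemma sym_vdm_halfM n :
  vdm_half false (fun i : 'I_n => 'X_i : {mpoly int[n]})
    * vdm_half true (fun i : 'I_n => 'X_i) \is symmetric.
Proof.
apply/issymP => s; rewrite msymM !msym_vdm_half.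
by case: odd_perm; rewrite //= mulrC.
Qed.

Lemma vdm_half_int n (G : {poly int}) : exists S P : int,
  forall (R : idomainType) (x : 'I_n -> R),
    map_poly intr G = \prod_(i < n) ('X - (x i)%:P) ->
  vdm_half false x + vdm_half true x = S%:~R /\
  vdm_half false x * vdm_half true x = P%:~R.
Proof.
have [S SE] := sym_mmap_int G (sym_vdm_halfD n).
have [P PE] := sym_mmap_int G (sym_vdm_halfM n).
exists S, P => R x GE; rewrite -(SE R x GE) -(PE R x GE) rmorphD rmorphM /=.
have mmap_half b : mmap intr x (vdm_half b (fun i => 'X_i)) = vdm_half b x.
  rewrite rmorph_vdm_half; apply: eq_vdm_half => i /=.
  by rewrite mmapX mmap1U.
by rewrite !mmap_half.
Qed.

(** [phi] shifts the [x i] cyclically. The [n]-th power of the shift is 1 and [n] is odd, so the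
    shift is even and preserves each half. *)
Lemma vdm_half_cyclic (R : comNzRingType) (phi : {rmorphism R -> R}) n b
    (x : 'I_n -> R) :
  odd n -> (forall i, phi (x i) = x (ordS i)) -> phi (vdm_half b x) = vdm_half b x.
Proof.
move=> n_odd phi_x; pose s := perm (@ordS_inj n).
have iter_s k (i : 'I_n) : iter k s i = ((i + k) %% n)%N :> nat.
  elim: k => [|k IHk]; first by rewrite addn0 modn_small.
  by rewrite iterS permE /= IHk -addn1 modnDml addn1 addnS.
have sXn : (s ^+ n = 1)%g.
  by apply/permP => i; apply: val_inj; rewrite permX /= iter_s perm1 modnDr modn_small.
have s_even : odd_perm s = false.
  have oddX k : odd_perm (s ^+ k)%g = odd k && odd_perm s.
    elim: k => [|k IHk]; first by rewrite odd_perm1.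
    by rewrite expgS odd_permM IHk /=; case: odd; case: odd_perm.
  by rewrite -[LHS]andTb -n_odd -oddX sXn odd_perm1.
rewrite rmorph_vdm_half -[in RHS](addbF b) -s_even -vdm_half_perm.
by apply: eq_vdm_half => i /=; rewrite phi_x permE.
Qed.

(** * The discriminant modulo 8 *)

(** Each reversed pair costs one sign. The total sign [e] is left unspecified, as the residues 3 and
    5 modulo 8 are opposite. *)
Lemma sqr_prod_ltn_sub (R : comNzRingType) n (x : 'I_n -> R) :
  exists e : bool, (\prod_(i < n) \prod_(j < n | (i < j)%N) (x j - x i)) ^+ 2
    = (-1) ^+ e * \prod_(i < n) \prod_(j < n | j != i) (x i - x j).
Proof.
set V := \prod_(i < n) _.
have [k VN] : exists k, \prod_(i < n) \prod_(j < n | (i < j)%N) (x i - x j)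
    = (-1) ^+ k * V.
  exists (\sum_(i < n) \sum_(j < n | (i < j)%N) 1)%N.
  rewrite expr_sum -big_split /=; apply: eq_bigr => i _.
  rewrite expr_sum -big_split /=; apply: eq_bigr => j _.
  by rewrite expr1 mulN1r opprB.
have -> : \prod_(i < n) \prod_(j < n | j != i) (x i - x j) = (-1) ^+ k * V * V.
  rewrite -VN /V [X in _ = _ * X](exchange_big_dep predT) //= -big_split /=.
  apply: eq_bigr => i _; rewrite (bigID (fun j : 'I_n => (i < j)%N)) /=.
  congr (_ * _); apply: eq_bigl => j; rewrite -val_eqE /=; lia.
by exists (odd k); rewrite signr_odd !mulrA -exprD -signr_odd addnn odd_double mul1r.
Qed.

(** [e2] is the second elementary symmetric function of [s]; the factor [N ^+ 2]
    avoids the exponents [size s - 1] and [size s - 2]. *)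
Lemma prod_affine_Aint (N : algC) (s : seq algC) : N \in Aint ->
    all (mem Aint) s ->
  exists e2 E : algC, [/\ e2 \in Aint, E \in Aint,
    2 * e2 = (\sum_(y <- s) y) ^+ 2 - \sum_(y <- s) y ^+ 2 &
    N ^+ 2 * \prod_(y <- s) (N + 2 * y)
      = N ^+ size s * (N ^+ 2 + 2 * N * (\sum_(y <- s) y) + 4 * e2) + 8 * E].
Proof.
move=> N_int; elim: s => [|y s IHs] /=.
  by exists 0, 0; rewrite !big_nil; split; rewrite ?rpred0 //; ring.
case/andP=> y_int s_int; have [e2 [E [e2_int E_int e2E prodE]]] := IHs s_int.
have sum_int : \sum_(y <- s) y \in Aint.
  by rewrite big_seq rpred_sum // => z /(allP s_int).
exists (e2 + y * \sum_(y <- s) y).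
exists (N ^+ size s * y * e2 + (N + 2 * y) * E).
split.
- by rewrite rpredD ?rpredM.
- by rewrite !rpredD ?rpredM ?rpredX ?rpredD ?rpredM ?rpred_nat.
- by rewrite mulrDr e2E !big_cons; ring.
by rewrite !big_cons mulrCA prodE (exprS N (size s)); ring.
Qed.

Lemma power_sum_eq0 (R : idomainType) n (x : 'I_n -> R) k :
  (forall j, (j < n)%N -> (n <= 3 * j)%N ->
    (\prod_(i < n) ('X - (x i)%:P))`_j = 0) ->
  (0 < k)%N -> (3 * k < 2 * n)%N -> \sum_(i < n) x i ^+ k = 0.
Proof.
move=> Q0 k_gt0 lt_k; have /= := newton_prod_XsubC x (n - k).-1.
have -> : (n - (n - k).-1 = k.+1)%N by lia.
rewrite prednK; last by lia.
rewrite Q0 ?mul0rn; [|by lia..].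
rewrite big_ord_recr /= subnK; last by lia.
rewrite big1 ?add0r => [|j _]; last by rewrite Q0 ?mul0r //; have := ltn_ord j; lia.
suff -> : (\prod_(i < n) ('X - (x i)%:P))`_n = 1 by rewrite mul1r.
have Q_monic : \prod_(i < n) ('X - (x i)%:P) \is monic by apply: monic_prod_XsubC.
rewrite -(monicP Q_monic) lead_coefE size_prod_XsubC.
by rewrite /index_enum -enumT size_enum_ord.
Qed.

(** The bound [m] is free because the lemma is applied with [n] to [h] and with [2 * n] to its
    square. *)
Lemma sum_horner_eq0 (R : comNzRingType) n m (x : 'I_n -> R) (h : {poly R}) :
  (forall k, (0 < k)%N -> (3 * k < m)%N -> \sum_(i < n) x i ^+ k = 0) ->
  (forall k, (k == 0%N) || (m <= 3 * k)%N -> h`_k = 0) ->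
  \sum_(i < n) h.[x i] = 0.
Proof.
move=> p0 h0; under eq_bigr => i _ do rewrite horner_coef.
rewrite exchange_big big1 // => k _; rewrite -mulr_sumr.
have [/h0->|] := boolP ((k == 0%N :> nat) || (m <= 3 * k)%N); first by rewrite mul0r.
by rewrite negb_or -ltnNge -lt0n => /andP[k_gt0 lt_k]; rewrite p0 ?mulr0.
Qed.

(** The values of [h] at the [x i] have vanishing first and second power sums, hence [e2 = 0]; only
    the leading term and multiples of 8 remain in the product. *)
Lemma prod_affine_mod8 (n : nat) (x : 'I_n -> algC) (h : {poly int})
    (N D : int) :
  (forall i, x i \in Aint) ->
  (forall k, (0 < k)%N -> (3 * k < 2 * n)%N -> \sum_(i < n) x i ^+ k = 0) ->
  (forall k, (k == 0%N) || (n <= 3 * k)%N -> h`_k = 0) ->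
  \prod_(i < n) (N%:~R + 2 * (map_poly intr h).[x i]) = D%:~R ->
  exists z : int, N ^+ 2 * D = N ^+ n * N ^+ 2 + 8 * z.
Proof.
move=> x_int p0 h0; set hC := map_poly intr h => prodE.
have hC0 k : (k == 0%N) || (n <= 3 * k)%N -> hC`_k = 0.
  by move=> /h0 hk; rewrite coef_map hk.
have hx_int i : hC.[x i] \in Aint.
  rewrite horner_coef rpred_sum // => k _.
  by rewrite rpredM ?rpredX // coef_map /= rpred_int.
pose s := [tuple hC.[x i] | i < n].
have s_int : all (mem Aint) s by apply/allP => _ /mapP[i _ ->]; apply: hx_int.
have N_int : (N%:~R : algC) \in Aint by rewrite rpred_int.
have [e2 [E [_ E_int]]] := prod_affine_Aint N_int s_int.
have sE (g : algC -> algC) : \sum_(y <- s) g y = \sum_(i < n) g hC.[x i].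
  by rewrite big_tuple; apply: eq_bigr => i _; rewrite tnth_mktuple.
rewrite !sE; have -> : \sum_(i < n) hC.[x i] = 0.
  by apply: sum_horner_eq0 hC0 => k k_gt0 lt_k; apply: p0 => //; lia.
have -> : \sum_(i < n) hC.[x i] ^+ 2 = 0.
  under eq_bigr => i _ do rewrite -horner_exp.
  apply: (sum_horner_eq0 p0) => k k_out; rewrite expr2 coefM big1 // => j _.
  have [/hC0->|] := boolP ((j == 0%N :> nat) || (n <= 3 * j)%N).
    by rewrite mul0r.
  rewrite negb_or -ltnNge => /andP[j_neq0 lt_j].
  by rewrite [hC`_(k - j)]hC0 ?mulr0 //;
    have := ltn_ord j; move: k_out j_neq0 lt_j; lia.
rewrite expr0n /= subr0 => /eqP; rewrite mulf_eq0 pnatr_eq0 /= => /eqP->.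
rewrite size_tuple card_ord !mulr0 !addr0.
have -> : \prod_(y <- s) (N%:~R + 2 * y) = D%:~R.
  by rewrite -prodE big_tuple; apply: eq_bigr => i _; rewrite tnth_mktuple.
move=> eqE.
(* The identity makes [E] rational; as an algebraic integer it is then an integer. *)
have EE : E = ratr ((N ^+ 2 * D - N ^+ n * N ^+ 2)%:~R / 8).
  have nz8 : (8 : algC) != 0 by rewrite pnatr_eq0.
  rewrite fmorph_div rmorph_int rmorph_nat.
  apply: (mulfI nz8); rewrite mulrCA divff // mulr1.
  by rewrite rmorphB !rmorphM !rmorphXn /= eqE; ring.
have /intrP[z zE] : E \is a Num.int by rewrite Cint_rat_Aint // EE Crat_rat.
exists z; apply: (@intr_inj algC).
by rewrite rmorphD !rmorphM !rmorphXn /= eqE zE.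
Qed.

Lemma disc_mod8 (n : nat) (G h : {poly int}) (S P : int) :
  odd n -> G \is monic -> size G = n.+1 -> G`_0 = 1 ->
  (forall j, (j < n)%N -> (n <= 3 * j)%N -> G`_j = 0) ->
  (forall k, (k == 0%N) || (n <= 3 * k)%N -> h`_k = 0) ->
  'X * G^`() = G *+ n - n%:R + h *+ 2 ->
  (forall (x : 'I_n -> algC),
    map_poly intr G = \prod_(i < n) ('X - (x i)%:P) ->
    vdm_half false x + vdm_half true x = S%:~R /\
    vdm_half false x * vdm_half true x = P%:~R) ->
  exists (e : bool) (z : int),
    n%:R ^+ 2 * ((-1) ^+ e * (S ^+ 2 - 4 * P)) = n%:R ^+ n * n%:R ^+ 2 + 8 * z.
Proof.
move=> n_odd G_monic size_G G_0 G_mid h_supp derG SP.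
pose Q := map_poly (intr : int -> algC) G.
have Q_monic : Q \is monic by rewrite monic_map.
have size_Q : size Q = n.+1 by rewrite size_map_poly_id0 // (monicP G_monic) oner_eq0.
have [x QE] : exists x : 'I_n -> algC, Q = \prod_(i < n) ('X - (x i)%:P).
  have [rs] := closed_field_poly_normal Q; rewrite (monicP Q_monic) scale1r => QE.
  have size_rs : size rs == n.
    by move: size_Q; rewrite QE size_prod_XsubC => -[->].
  by exists (tnth (Tuple size_rs));
    rewrite -(big_tuple _ _ (Tuple size_rs) xpredT (fun c => 'X - c%:P)).
have [SE PE] := SP x QE.
have rootQ i : root Q (x i) by rewrite QE (bigD1 i) //= rootM root_XsubC eqxx.
have x_int i : x i \in Aint.
  apply: root_monic_Aint (rootQ i) Q_monic _.
  by apply/polyOverP => k; rewrite coef_map intr_int.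
have p0 k : (0 < k)%N -> (3 * k < 2 * n)%N -> \sum_(i < n) x i ^+ k = 0.
  apply: power_sum_eq0 => j lt_jn le_nj; rewrite -QE coef_map.
  by rewrite /= G_mid.
have [e discE] := sqr_prod_ltn_sub x.
have {}discE : \prod_(i < n) Q^`().[x i] = (-1) ^+ e * (S ^+ 2 - 4 * P)%:~R.
  rewrite rmorphB !rmorphM /= -SE -PE.
  transitivity ((-1) ^+ e * (vdm_half false x - vdm_half true x) ^+ 2); last by ring.
  rewrite vdm_halfB discE mulrA -expr2 sqrr_sign mul1r.
  by apply: eq_bigr => i _; rewrite QE horner_deriv_prod_XsubC.
have prod_x : \prod_(i < n) x i = -1.
  have : Q`_0 = 1 by rewrite coef_map /= G_0.
  rewrite -horner_coef0 QE horner_prod.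
  under eq_bigr => i _ do rewrite hornerXsubC sub0r -mulN1r.
  rewrite big_split /= prodr_const card_ord -signr_odd n_odd expr1 mulN1r.
  by move/eqP; rewrite eqr_oppLR => /eqP.
(* At a root, [derG] equates [x i] times the derivative with [- n] plus twice the value of [h]. The
   product [-1] of the roots turns [e] into [e.+1]. *)
have [z zE] : exists z : int, (- n%:R) ^+ 2 * ((-1) ^+ e.+1 * (S ^+ 2 - 4 * P))
     = (- n%:R) ^+ n * (- n%:R) ^+ 2 + 8 * z.
  apply: (prod_affine_mod8 x_int p0 h_supp).
  rewrite rmorphM rmorphXn rmorphN1 exprS -mulrA /= -discE -prod_x -big_split /=.
  apply: eq_bigr => i _; have := congr1 (fun p => (map_poly intr p).[x i]) derG.
  rewrite rmorphM rmorphD rmorphB !rmorphMn /= map_polyX -deriv_map !hornerE.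
  rewrite !hornerMn (rootP (rootQ i)) mul0rn sub0r -mulr_natl => ->.
  by rewrite /= rmorph1 hornerC mulr1 mulrNz [2 * _]mulr_natl mulr2n addrA mulrz_nat.
exists e, (- z); move: zE.
rewrite (exprNn _ n) -(signr_odd _ n) n_odd expr1 sqrrN (exprS _ e) => zE.
transitivity (- (n%:R ^+ 2 * (-1 * (-1) ^+ e * (S ^+ 2 - 4 * P)))); first by ring.
by rewrite zE; ring.
Qed.

(** Odd squares are 1 modulo 8, so [n ^+ n] is [n] and [S ^+ 2 - 4 * P] is 3 or 5. An even [S] would
    make it a multiple of 4; an odd [S] makes it [1 - 4 * P], so [P] is odd. *)
Lemma odd_of_disc_mod8 (n : nat) (S P z : int) (e : bool) :
  (n = 3 %[mod 8])%N \/ (n = 5 %[mod 8])%N ->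
  n%:R ^+ 2 * ((-1) ^+ e * (S ^+ 2 - 4 * P)) = n%:R ^+ n * n%:R ^+ 2 + 8 * z ->
  (exists s, S = 2 * s + 1) /\ (exists p, P = 2 * p + 1).
Proof.
move=> n_mod8; pose N : int := n%:R; rewrite -/N => eqD.
have n_odd : odd n by case: n_mod8; lia.
have [q [r [nE rE]]] : exists q r : int, N = 8 * q + r /\ (r = 3 \/ r = 5).
  case: n_mod8 => n_mod8; [exists (n %/ 8)%N%:Z, 3 | exists (n %/ 8)%N%:Z, 5];
    split; [lia | by left | lia | by right].
have [w N2] : exists w, N ^+ 2 = 1 + 8 * w.
  by case: rE => rE; rewrite nE rE; [exists (8 * q ^+ 2 + 6 * q + 1)
    | exists (8 * q ^+ 2 + 10 * q + 3)]; ring.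
have [v NX] : exists v, N ^+ n = N + 8 * v.
  have -> : n = (n./2 * 2).+1 by lia.
  rewrite exprS mulnC exprM N2.
  have [v ->] : exists v, (1 + 8 * w) ^+ n./2 = 1 + 8 * v.
    elim: n./2 => [|k [v IHk]]; first by exists 0; rewrite expr0; ring.
    by exists (w + v + 8 * w * v); rewrite exprS IHk; ring.
  by exists (N * v); ring.
have {eqD} [u uE] : exists u,
    S ^+ 2 - 4 * P = 8 * u + 3 \/ S ^+ 2 - 4 * P = 8 * u + 5.
  set D := S ^+ 2 - 4 * P in eqD *.
  have {}eqD : (-1) ^+ e * D =
      r + 8 * (q + v + w * (r + 8 * q + 8 * v) + z - w * ((-1) ^+ e * D)).
    have : N ^+ 2 * ((-1) ^+ e * D) = (N + 8 * v) * N ^+ 2 + 8 * z by rewrite -NX.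
    rewrite N2 nE => eqD'.
    transitivity ((1 + 8 * w) * ((-1) ^+ e * D) - 8 * w * ((-1) ^+ e * D)).
      by ring.
    by rewrite eqD'; ring.
  set t := (_ + _ - _ : int) in eqD; move: t eqD => t.
  case: e; rewrite ?expr0 ?expr1 ?mulN1r ?mul1r => eqD.
    (* Here [D = - r - 8 * t = 8 * (- t - 1) + (8 - r)], and [8 - r] exchanges 3 and 5. *)
    by exists (- t - 1); case: rE => rE; [right | left]; lia.
  by exists t; case: rE => rE; [left | right]; lia.
have [s [b [SE b01]]] : exists s b : int, S = 2 * s + b /\ (b = 0 \/ b = 1).
  exists (S %/ 2)%Z, (S %% 2)%Z; split; lia.
have [p [c [PE c01]]] : exists p c : int, P = 2 * p + c /\ (c = 0 \/ c = 1).
  exists (P %/ 2)%Z, (P %% 2)%Z; split; lia.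
have [y yE] : exists y : int, s * (s + 1) = 2 * y.
  have [k [a [-> a01]]] : exists k a : int, s = 2 * k + a /\ (a = 0 \/ a = 1).
    exists (s %/ 2)%Z, (s %% 2)%Z; split; lia.
  by case: a01 => ->; [exists (k * (2 * k + 1)) | exists ((2 * k + 1) * (k + 1))]; ring.
have S2 : S ^+ 2 = 8 * y - 4 * s * (1 - b) + b ^+ 2.
  have -> : 8 * y = 4 * (2 * y) by ring.
  by rewrite -yE SE; ring.
move: uE; rewrite S2 PE; case: b01 SE => -> ->; case: c01 => -> uE.
- by case: uE; lia.
- by case: uE; lia.
- by case: uE; lia.
by split; [exists s | exists p].
Qed.

(** * Frobenius conjugates and reduction modulo 2 *)

Lemma frobenius_conj_ordS (F : finFieldType) n (card_F : #|F| = (2 ^ n)%N)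
    (char2 : 2 \in [pchar F]) (alpha : F) (i : 'I_n) :
  pFrobenius_aut char2 (alpha ^+ (2 ^ i)) = alpha ^+ (2 ^ ordS i).
Proof.
rewrite pFrobenius_autE -exprM -expnSr /=.
have [lt_in|le_ni] := ltnP i.+1 n; first by rewrite modn_small.
have -> : i.+1 = n by have := ltn_ord i; lia.
by rewrite modnn expn0 -card_F expf_card.
Qed.

Lemma frobenius_fixed (F : idomainType) (char2 : 2 \in [pchar F]) (c : F) :
  pFrobenius_aut char2 c = c -> c = 0 \/ c = 1.
Proof.
rewrite pFrobenius_autE => cc; have /eqP : c * (c - 1) = 0.
  by rewrite mulrBr mulr1 -expr2 cc subrr.
by rewrite mulf_eq0 subr_eq0 => /orP[] /eqP; [left | right].
Qed.

(** Frobenius permutes the factors of the product, so it descends to ['F_2]. There it shares a root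
    with the irreducible [f], is divisible by it, and has the same degree. *)
Lemma map_irreducible_conjugates (F : finFieldType) n
    (card_F : #|F| = (2 ^ n)%N) (iota : {rmorphism 'F_2 -> F})
    (f : {poly 'F_2}) (alpha : F) :
  (0 < n)%N -> irreducible_poly f -> f \is monic -> size f = n.+1 ->
  root (map_poly iota f) alpha ->
  map_poly iota f = \prod_(i < n) ('X - (alpha ^+ (2 ^ i))%:P).
Proof.
move=> n_gt0 f_irr f_monic size_f f_alpha; set h := \prod_(i < n) _.
have char2 : 2 \in [pchar F] := card_finPcharP card_F isT.
pose phi : {rmorphism F -> F} := pFrobenius_aut char2.
have size_h : size h = n.+1.
  by rewrite size_prod_XsubC /index_enum -enumT size_enum_ord.
have h_monic : h \is monic by apply: monic_prod_XsubC.
have phi_h : map_poly phi h = h.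
  rewrite rmorph_prod [RHS](reindex_inj (@ordS_inj n)); apply: eq_bigr => i _.
  by rewrite rmorphB /= map_polyX map_polyC /= -(frobenius_conj_ordS card_F char2).
have [h0 h0E] : exists h0, h = map_poly iota h0.
  (* Coefficients fixed by Frobenius are 0 or 1, so the test against 1 gives their preimages in
     ['F_2]. *)
  exists (\poly_(i < n.+1) (h`_i == 1)%:R); apply/polyP => k.
  rewrite coef_map coef_poly; case: ltnP => [_|le_nk]; last first.
    by rewrite nth_default ?size_h //; apply/esym/(rmorph0 iota).
  have : phi h`_k = h`_k by rewrite -[in RHS]phi_h coef_map.
  by case/frobenius_fixed => ->; rewrite ?eqxx ?(eq_sym 0) ?oner_eq0;
    [apply/esym/(rmorph0 iota) | apply/esym/(rmorph1 iota)].
have f_dvd_h0 : f %| h0.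
  apply: contraT; rewrite -irreducible_poly_coprime // -(coprimep_map iota) -h0E.
  move/coprimep_root/(_ f_alpha); rewrite -rootE /h.
  rewrite (bigD1 (Ordinal n_gt0)) //= rootM root_XsubC.
  by rewrite expn0 expr1 eqxx.
have size_h0 : size h0 = n.+1 by rewrite -size_h h0E size_map_poly.
have h0_monic : h0 \is monic by rewrite -(map_monic iota) -h0E.
rewrite h0E; congr (map_poly iota _); apply/eqP.
by rewrite -eqp_monic // -dvdp_size_eqp // size_f size_h0.
Qed.

(** In Newton's identity at [k] the left side vanishes as [k] is even, and the power sums of
    positive index are vanishing traces. What is left is [n] times the coefficient, with [n] odd. *)
Lemma even_coef_eq0 (F : finFieldType) n (card_F : #|F| = (2 ^ n)%N)
    (iota : {rmorphism 'F_2 -> F}) (f : {poly 'F_2}) (alpha : F) k :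
  odd n ->
  map_poly iota f = \prod_(i < n) ('X - (alpha ^+ (2 ^ i))%:P) ->
  (forall i : nat, (1 <= i < n)%N -> abs_trace n (alpha ^+ i) = 0) ->
  (0 < k)%N -> (k < n)%N -> ~~ odd k -> f`_k = 0.
Proof.
move=> n_odd fE tr0 k_gt0 lt_kn k_even.
have char2 : 2 \in [pchar F] := card_finPcharP card_F isT.
have two0 m : ~~ odd m -> m%:R = 0 :> F.
  by move=> m_even; apply/eqP; rewrite -(dvdn_pcharf char2) dvdn2.
have := newton_prod_XsubC (fun i : 'I_n => alpha ^+ (2 ^ i)) k.-1.
rewrite -fE prednK //= -mulr_natr two0 // mulr0.
have -> : (n - k.-1 = (n - k).+1)%N by lia.
rewrite big_ord_recl [X in _ = _ + X]big1 => [|i _]; last first.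
  transitivity ((map_poly iota f)`_(k + bump 0 i) * abs_trace n (alpha ^+ bump 0 i)).
    by congr (_ * _); apply: eq_bigr => j _; rewrite -!exprM mulnC.
  by rewrite tr0 ?mulr0 // /bump /=; have := ltn_ord i; lia.
under eq_bigr => i _ do rewrite expr0.
rewrite sumr_const card_ord addn0 addr0 -[n]odd_double_half n_odd natrD
  (two0 n./2.*2) ?odd_double //.
rewrite addr0 mulr1 coef_map => /esym/eqP.
by rewrite fmorph_eq0 => /eqP.
Qed.

(** Both halves are fixed by Frobenius, hence 0 or 1. If their product is 1, both are 1 and their
    sum is 0, not 1. *)
Lemma vdm_half_conjugates (F : finFieldType) n (card_F : #|F| = (2 ^ n)%N)
    (alpha : F) (S P : int) :
  odd n ->
  (let x := fun i : 'I_n => alpha ^+ (2 ^ i) in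
    vdm_half false x + vdm_half true x = S%:~R /\
    vdm_half false x * vdm_half true x = P%:~R) ->
  ~ ((exists s, S = 2 * s + 1) /\ (exists p, P = 2 * p + 1)).
Proof.
move=> n_odd /= [SE PE] [[s Ss] [p Pp]].
have char2 : 2 \in [pchar F] := card_finPcharP card_F isT.
have oddE z : (2 * z + 1)%:~R = 1 :> F.
  by rewrite rmorphD rmorphM /= -[2%:~R]/(2%:R) (pcharf0 char2) mul0r add0r.
have half01 b : vdm_half b (fun i : 'I_n => alpha ^+ (2 ^ i)) = 0 \/
    vdm_half b (fun i : 'I_n => alpha ^+ (2 ^ i)) = 1.
  apply: (frobenius_fixed (char2 := char2)); apply: vdm_half_cyclic => // i.
  exact: frobenius_conj_ordS.
move: SE PE; rewrite Ss Pp !oddE.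
case: (half01 false) (half01 true) => -> [] ->; rewrite ?mul0r ?mulr0.
all: try by move=> _ /esym/eqP; rewrite oner_eq0.
by move=> /eqP; rewrite -subr_eq0 addrK oner_eq0.
Qed.

(** * The integer lift and the contradiction *)

Lemma F2_eq1 (c : 'F_2) : c != 0 -> c = 1.
Proof. by case: c => [[|[|//]]] //= ? _; apply: val_inj. Qed.

Theorem corollary1p1 (n : nat) (n_gt0 : (0 < n)%N)
    (n_mod8 : (n = 3 %[mod 8])%N \/ (n = 5 %[mod 8])%N)
    (F : finFieldType) (card_F : #|F| = (2 ^ n)%N)
    (iota : {rmorphism 'F_2 -> F})
    (f : {poly 'F_2}) (f_irr : irreducible_poly f) (deg_f : size f = n.+1)
    (alpha : F) (f_alpha : root (map_poly iota f) alpha)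
    (tr_alpha : forall i : nat, (1 <= i < n)%N -> abs_trace n (alpha ^+ i) = 0) :
  exists k : nat, [/\ (k < n)%N, (n <= 3 * k)%N & f`_k != 0].
Proof.
have n_odd : odd n by case: n_mod8; lia.
have n_gt1 : (1 < n)%N by case: n_mod8; lia.
have [/existsP[k /andP[le_nk fk]]|/existsPn no_k] :=
  boolP [exists k : 'I_n, (n <= 3 * k)%N && (f`_k != 0)].
  by exists k.
exfalso.
have f_mid k : (k < n)%N -> (n <= 3 * k)%N -> f`_k = 0.
  move=> lt_kn le_nk; have := no_k (Ordinal lt_kn).
  by rewrite /= le_nk negbK => /eqP.
have f_monic : f \is monic.
  by apply/eqP/F2_eq1; rewrite lead_coef_eq0 -size_poly_gt0 deg_f.
have f_0 : f`_0 = 1.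
  apply: F2_eq1; apply/negP => f0.
  have X_dvd_f : 'X %| f.
    by rewrite -['X]subr0 -polyC0 dvdp_XsubCl rootE horner_coef0.
  have /eqp_size : 'X %= f by apply: f_irr.2; rewrite ?size_polyX.
  by rewrite size_polyX deg_f; lia.
have fE := map_irreducible_conjugates card_F n_gt0 f_irr f_monic deg_f f_alpha.
have f_even k : (0 < k)%N -> (k < n)%N -> ~~ odd k -> f`_k = 0.
  exact (even_coef_eq0 card_F n_odd fE tr_alpha).
pose c k : int := (nat_of_ord f`_k%R)%:Z.
have c0 k : f`_k = 0 -> c k = 0 by rewrite /c => ->.
have c1 k : f`_k = 1 -> c k = 1 by rewrite /c => ->.
pose G := \poly_(k < n.+1) c k.
(* The choice comes from [k = n - (n - k)]. For [0 < k < n] a nonzero [c k] forces [k] odd, so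
   [n - k] is even and halving is exact. At [k = 0] the subtracted constant [n] does the work. *)
pose h := \poly_(k < n) (if k == 0%N then 0 else - c k *+ (n - k)./2).
have f_n : f`_n = 1 by move/monicP: f_monic; rewrite lead_coefE deg_f.
have G_n : G`_n = 1 by rewrite coef_poly ltnSn c1.
have size_G : size G = n.+1.
  by rewrite size_poly_eq // c1 ?oner_eq0.
have G_monic : G \is monic by rewrite monicE lead_coefE size_G G_n.
have mapG : map_poly intr G = map_poly iota f.
  apply/polyP => k; rewrite !coef_map coef_poly /=.
  case: ltnP => [_|le_nk]; last first.
    by rewrite nth_default ?deg_f //; apply/esym/(rmorph0 iota).
  by rewrite -pmulrn -(rmorph_nat iota); congr (iota _); apply: natr_Zp.
have [S [P SP]] := vdm_half_int n G.
have derG : 'X * G^`() = G *+ n - n%:R + h *+ 2.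
  apply/polyP => -[|k].
    rewrite coefXM coefD coefB !coefMn !coef_poly n_gt0 /= c1 //.
    by rewrite coef1 subrr mul0rn addr0.
  rewrite coefXM coefD coefB !coefMn coef1 mul0rn subr0 coef_deriv !coef_poly /=.
  rewrite ltnS; case: (ltngtP k.+1 n) => [lt_kn|_|->]; rewrite ?mul0rn ?addr0 //.
  have [k_odd|k_even] := boolP (odd k.+1); last first.
    by rewrite c0 ?f_even // oppr0 !mul0rn addr0.
  rewrite -mulrnA.
  have -> : ((n - k.+1)./2 * 2 = n - k.+1)%N.
    by rewrite muln2 -[RHS]odd_double_half oddB 1?ltnW // n_odd k_odd.
  by rewrite mulNrn mulrnBr 1?ltnW // opprB addrC subrK.
have [e [z eqD]] : exists (e : bool) (z : int),
    n%:R ^+ 2 * ((-1) ^+ e * (S ^+ 2 - 4 * P)) = n%:R ^+ n * n%:R ^+ 2 + 8 * z.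
  apply: disc_mod8 n_odd G_monic size_G _ _ _ derG (SP _).
  - by rewrite coef_poly c1.
  - by move=> k lt_kn le_nk; rewrite coef_poly c0 ?if_same ?f_mid.
  move=> k; rewrite coef_poly; case: ltnP => // lt_kn.
  by case: eqP => //= _ le_nk; rewrite c0 ?f_mid // oppr0 mul0rn.
(* The [S] and [P] constrained through [algC] are now read at the conjugates of [alpha]. *)
apply: (vdm_half_conjugates card_F n_odd (SP F _ _)); last first.
  exact: odd_of_disc_mod8 n_mod8 eqD.
by rewrite mapG fE.
Qed.
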